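(* Let $\Sigma$ be a covariance matrix of full rank $n$. If $\boldsymbol{\nu}$ is an $n$-tuple of umbral monomials such that $f(\boldsymbol{\nu},\boldsymbol{t})=1+\frac12\boldsymbol{t}\Sigma^{-1}\boldsymbol{t}^T$ and $\boldsymbol{\mu}$ is an $n$-tuple of umbral monomials such that $f(\boldsymbol{\mu},\boldsymbol{t})=1+\frac12\boldsymbol{t}\Sigma\boldsymbol{t}^T$, then for all $\boldsymbol{i}\in\mathbb{N}_0^n$ $$H_{\boldsymbol{i}}(\boldsymbol{x},\Sigma)\simeq(-1\boldsymbol{.}\beta\boldsymbol{.}\boldsymbol{\nu}+\boldsymbol{x}\Sigma^{-1})^{\boldsymbol{i}},\qquad \tilde H_{\boldsymbol{i}}(\boldsymbol{x},\Sigma)\simeq(-1\boldsymbol{.}\beta\boldsymbol{.}\boldsymbol{\mu}+\boldsymbol{x})^{\boldsymbol{i}},$$ i.e. each polynomial on the left equals the evaluation under $E$ of the right-hand side.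
   Context: Vectors $\boldsymbol{x}=(x_1,\dots,x_n)$ and $\boldsymbol{t}=(t_1,\dots,t_n)$ are row vectors. Multivariate Hermite polynomials: $H_{\boldsymbol{i}}(\boldsymbol{x},\Sigma)=(-1)^{|\boldsymbol{i}|}\,D^{(\boldsymbol{i})}_{\boldsymbol{x}}\phi(\boldsymbol{x};\boldsymbol{0},\Sigma)/\phi(\boldsymbol{x};\boldsymbol{0},\Sigma)$, where $\phi(\boldsymbol{x};\boldsymbol{0},\Sigma)$ is the density of the multivariate Gaussian with mean $\boldsymbol{0}$ and covariance matrix $\Sigma$, $|\boldsymbol{i}|=i_1+\cdots+i_n$ and $D^{(\boldsymbol{i})}_{\boldsymbol{x}}=\partial^{|\boldsymbol{i}|}/\partial x_1^{i_1}\cdots\partial x_n^{i_n}$; and $\tilde H_{\boldsymbol{i}}(\boldsymbol{x},\Sigma)=H_{\boldsymbol{i}}(\boldsymbol{x}\Sigma^{-1},\Sigma^{-1})$. Umbral calculus: $R$ is the real or complex field, $A$ a set of symbols (umbrae), $E:R[A]\to R$ a linear functional with $E[1]=1$ and $E[\alpha^i\gamma^j\cdots]=E[\alpha^i]E[\gamma^j]\cdots$ for distinct umbrae; the components of $\boldsymbol{x}$ are treated as constants for $E$. $p\simeq q$ means $E[p]=E[q]$. An $n$-tuple $\boldsymbol{\nu}$ of umbral monomials (monomials in $R[A]$) has moments $g_{\boldsymbol{i}}=E[\boldsymbol{\nu}^{\boldsymbol{i}}]$, $\boldsymbol{\nu}^{\boldsymbol{i}}=\nu_1^{i_1}\cdots\nu_n^{i_n}$,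 and generating function $f(\boldsymbol{\nu},\boldsymbol{t})=1+\sum_{\boldsymbol{i}\ne\boldsymbol{0}}g_{\boldsymbol{i}}\boldsymbol{t}^{\boldsymbol{i}}/\boldsymbol{i}!$, $\boldsymbol{i}!=i_1!\cdots i_n!$. A partition $\boldsymbol{\lambda}\vdash\boldsymbol{i}$ of a multi-index is a matrix of nonnegative integers with $n$ rows, no zero column, columns in lexicographic order, and $r$-th row sum $i_r$; $l(\boldsymbol{\lambda})$ is its number of columns; if its distinct columns $\boldsymbol{\lambda}_1,\boldsymbol{\lambda}_2,\dots$ have multiplicities $r_1,r_2,\dots$, then $\mathfrak{m}(\boldsymbol{\lambda})!=r_1!r_2!\cdots$, $\boldsymbol{\lambda}!=\prod_j(\boldsymbol{\lambda}_j!)^{r_j}$, $g_{\boldsymbol{\lambda}}=\prod_jg_{\boldsymbol{\lambda}_j}^{r_j}$. The auxiliary umbra $-1\boldsymbol{.}\beta\boldsymbol{.}\boldsymbol{\nu}$ ($\beta$ denotes the Bell umbra) is the symbolic $n$-tuple with moments $$E[(-1\boldsymbol{.}\beta\boldsymbol{.}\boldsymbol{\nu})^{\boldsymbol{i}}]=\sum_{\boldsymbol{\lambda}\vdash\boldsymbol{i}}\frac{\boldsymbol{i}!}{\mathfrak{m}(\boldsymbol{\lambda})!\,\boldsymbol{\lambda}!}(-1)^{l(\boldsymbol{\lambda})}g_{\boldsymbol{\lambda}}.$$ For a constant row vector $\boldsymbol{c}$, the power $(-1\boldsymbol{.}\beta\boldsymbol{.}\boldsymbol{\nu}+\boldsymbol{c})^{\boldsymbol{i}}$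 is the $\boldsymbol{i}$-th power of the componentwise sum, expanded by the binomial theorem in each component. *)

(* Defs.v *)
From HB Require Import structures.
(* mpoly must be imported before mathcomp-analysis, as its notations clash with
   it in the other order; monalg also has conflicting notations. Below,
   malg (cmonom A) K is the polynomial ring K[A] (the type cmonom A is that of
   monomials in A), and mkmalgU m 1 is the monomial m as an element of it. *)
From mathcomp Require Import all_boot all_order all_algebra.
From mathcomp Require Import -(notations) monalg.
From mathcomp Require Import mpoly.
From mathcomp Require Import all_classical all_reals all_analysis.
From mathcomp Require Import complex.
Import Order.TTheory GRing.Theory Num.Theory.
Import numFieldNormedType.Exports.

Set Implicit Arguments.
Unset Strict Implicit.
Unset Printing Implicit Defensive.

Local Open Scope ring_scope.

(* Multi-indices are the monomials 'X_{1..n} of mpoly; mdeg i is |i|. *)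

Definition mnm_fact n (i : 'X_{1..n}) : nat := (\prod_(r < n) (i r)`!)%N.

Definition mnm_lexi n : rel 'X_{1..n} :=
  fun a b => ((val (val a) : seqlexi nat) <= (val (val b) : seqlexi nat))%O.

Section Partitions.
Variables (n l : nat) (la : 'M[nat]_(n, l)).

Definition part_cols : seq 'X_{1..n} :=
  [seq [multinom la r j | r < n] | j <- enum 'I_l].

Definition is_multipart (i : 'X_{1..n}) : bool :=
  [&& all (fun c => c != 0%MM) part_cols,
      sorted (@mnm_lexi n) part_cols
    & [forall r, (\sum_(j < l) la r j)%N == i r]].

Definition part_mult_fact : nat :=
  (\prod_(c <- undup part_cols) (count_mem c part_cols)`!)%N.

Definition part_fact : nat :=
  (\prod_(c <- undup part_cols) mnm_fact c ^ count_mem c part_cols)%N.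

Definition part_moment (K : fieldType) (g : 'X_{1..n} -> K) : K :=
  \prod_(c <- undup part_cols) g c ^+ count_mem c part_cols.

(* A partition of i has at most |i| columns, and entries at most |i|; this is
   why the finite sum in neg_bell_moment ranges over all partitions. *)
Lemma is_multipart_bounded (i : 'X_{1..n}) : is_multipart i ->
  (l <= mdeg i)%N /\ forall r j, (la r j <= mdeg i)%N.
Proof.
case/and3P=> /allP nz _ /forallP rows.
have degE : mdeg i = (\sum_(j < l) \sum_(r < n) la r j)%N.
  rewrite exchange_big mdegE; apply: eq_bigr => r _.
  by rewrite (eqP (rows r)).
split=> [|r j].
  rewrite degE -[X in (X <= _)%N]card_ord -sum1_card.
  apply: leq_sum => j _; rewrite lt0n; apply/negP => /eqP col0.
  have /nz /negP[] : [multinom la r j | r < n] \in part_cols.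
    by apply/mapP; exists j; rewrite ?mem_enum.
  apply/eqP/mnmP => r; rewrite mnmE mnm0E; apply/eqP.
  by rewrite -leqn0 -col0 (bigD1 r) //= leq_addr.
by rewrite degE (bigD1 j) //= (bigD1 r) //= -addnA leq_addr.
Qed.

End Partitions.

(* The moments of the auxiliary umbra -1.beta.nu, where g gives those of nu. *)
Definition neg_bell_moment (K : fieldType) n (g : 'X_{1..n} -> K)
    (i : 'X_{1..n}) : K :=
  \sum_(l < (mdeg i).+1)
    \sum_(la : 'M['I_(mdeg i).+1]_(n, l)
          | is_multipart (map_mx val la : 'M[nat]_(n, l)) i)
      let la' : 'M[nat]_(n, l) := map_mx val la in
      (mnm_fact i)%:R / ((part_mult_fact la')%:R * (part_fact la')%:R)
        * (-1) ^+ l * part_moment la' g.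

(* Evaluation of a polynomial p in a symbolic n-tuple of umbrae, represented by
   the variables 'X_1, ..., 'X_n, whose i-th moment is g i; the coefficients of
   p are constants for E. *)
Definition moment_eval (K : fieldType) n (g : 'X_{1..n} -> K)
    (p : {mpoly K[n]}) : K :=
  \sum_(m <- msupp p) p@_m * g m.

(* The i-th power of the componentwise sum of the symbolic n-tuple and c. *)
Definition shifted_power (K : fieldType) n (c : 'rV[K]_n) (i : 'X_{1..n}) :
    {mpoly K[n]} :=
  \prod_(r < n) ('X_r + (c 0 r)%:MP) ^+ i r.

Section Umbral.
Variables (K : fieldType) (A : choiceType).
Variable E : malg (cmonom A) K -> K.

Definition umbra (a : A) : malg (cmonom A) K := mkmalgU (ucm a) 1.

Definition umbral_functional : Prop :=
  [/\ scalar E,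
      E 1 = 1
    & forall (s : seq A) (e : A -> nat), uniq s ->
        E (\prod_(a <- s) umbra a ^+ e a) = \prod_(a <- s) E (umbra a ^+ e a)].

Variables (n : nat) (nu : 'I_n -> cmonom A).

Definition umbral_moment (i : 'X_{1..n}) : K :=
  E (\prod_(r < n) mkmalgU (nu r) 1 ^+ i r).

(* A formal power series in t_1, ..., t_n is given by its coefficients: this is
   the coefficient of t^i in f(nu, t). *)
Definition umbral_gf (i : 'X_{1..n}) : K :=
  if i == 0%MM then 1 else umbral_moment i / (mnm_fact i)%:R.

End Umbral.

(* 1 + t M t^T / 2, a polynomial in t_1, ..., t_n. *)
Definition quadratic_gf (K : fieldType) n (M : 'M[K]_n) : {mpoly K[n]} :=
  let t : 'rV[{mpoly K[n]}]_n := \row_j 'X_j in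
  1 + (2%:R^-1)%:MP * (t *m map_mx (@mpolyC n K) M *m t^T) 0 0.

(* The base field K is the real or the complex field, with the embedding of the
   reals into it. *)
Variant real_or_complex (R : realType) :
    forall K : fieldType, {rmorphism R -> K} -> Prop :=
| BaseReal : real_or_complex (idfun : {rmorphism R -> R})
| BaseComplex : real_or_complex (real_complex R : {rmorphism R -> R[i]}).

Section Gaussian.
Variables (R : realType) (n : nat).

Definition is_covariance_matrix (S : 'M[R]_n) : Prop :=
  exists (d : measure_display) (T : measurableType d) (P : probability T R)
         (X : 'I_n -> {RV P >-> R}),
    (forall j, (X j : T -> R) \in Lfun P 2%:E) /\
    (forall j k, covariance P (X j) (X k) = (S j k)%:E).

Definition gauss_pdf (m : 'rV[R]_n) (S : 'M[R]_n) (x : 'rV[R]_n) : R :=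
  (Num.sqrt ((2 * pi) ^+ n * \det S))^-1
    * expR (- (((x - m) *m invmx S *m (x - m)^T) 0 0 / 2)).

(* delta_mx 0 r is the r-th basis vector; x_1 is differentiated last. *)
Definition partial (r : 'I_n) (f : 'rV[R]_n -> R) : 'rV[R]_n -> R :=
  fun x => 'D_(delta_mx 0 r) f x.

Definition mpartial (i : 'X_{1..n}) (f : 'rV[R]_n -> R) : 'rV[R]_n -> R :=
  foldr (fun r => iter (i r) (partial r)) f (enum 'I_n).

Definition hermite (i : 'X_{1..n}) (x : 'rV[R]_n) (S : 'M[R]_n) : R :=
  (-1) ^+ mdeg i * mpartial i (gauss_pdf 0 S) x / gauss_pdf 0 S x.

Definition hermite_tilde (i : 'X_{1..n}) (x : 'rV[R]_n) (S : 'M[R]_n) : R :=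
  hermite i (x *m invmx S) (invmx S).

End Gaussian.

(* Main.v *)
(* Write y = x M with M = Sigma^-1, and phi for the Gaussian density. Since
   d_r phi = - y_r phi, differentiation sends p(y) phi to - (A_r p)(y) phi, where
   A_r p = X_r p - sum_s M_rs d_s p; hence H_i is the value at y of
   A_1^(i_1) ... A_n^(i_n) 1. Moreover [d_s, A_r] = delta_rs, so
   d_s H_i = i_s H_(i - e_s) as polynomials in y, and H_(i + e_r) = y_r H_i - sum_s M_rs i_s H_(i - e_s).

   Let a_i be the moments of -1.beta.nu. Then a_i / i! is the sum over the multisets of nonzero multi-indices
   with sum i of prod_c w_c^(m_c) / m_c!, with w_c = - g_c / c!. Removing one element c
   from a multiset gives i_r b_i = sum_c c_r w_c b_(i - c) for b_i = a_i / i!, and for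
   the quadratic generating function this reads
   a_(i + e_r) = - sum_s M_rs i_s a_(i - e_s). Hence evaluating the shifted power
   satisfies the same recursion in i as H_i.

   The second identity is the first one for Sigma^-1. A nonsingular positive
   semidefinite matrix has positive determinant, so that phi does not vanish. *)
Require Import Defs.
From HB Require Import structures.
From mathcomp Require Import all_boot all_order all_algebra.
From mathcomp Require Import -(notations) monalg.
From mathcomp Require Import mpoly.
From mathcomp Require Import all_classical all_reals all_analysis.
From mathcomp Require Import complex ring.
From mathcomp Require polyrcf.
Import Order.TTheory GRing.Theory Num.Theory.
Import numFieldNormedType.Exports.
Local Open Scope ring_scope.

Set Implicit Arguments.
Unset Strict Implicit.
Unset Printing Implicit Defensive.

(** * Partitions of multi-indices *)

Section MultiplicityFactorial.
Context {T : eqType}.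

(** The factor [part_mult_fact] freed from its matrix, so that it can be followed when an element of
    the sequence is removed. *)
Definition mult_fact (s : seq T) : nat :=
  (\prod_(c <- undup s) (count_mem c s)`!)%N.

(** Elements of [u] outside [s] contribute 0! = 1. Products for two different sequences can thus be
    compared over one common index list. *)
Lemma mult_factE (u s : seq T) : uniq u -> {subset s <= u} ->
  mult_fact s = (\prod_(c <- u) (count_mem c s)`!)%N.
Proof.
move=> uu su; rewrite [RHS](bigID (mem s)) /= [X in (_ * X)%N]big1 => [|c cs]; last first.
  by rewrite (count_memPn cs).
rewrite muln1 -big_filter; apply: perm_big; apply: uniq_perm.
- exact: undup_uniq.
- exact: filter_uniq.
by move=> c; rewrite mem_undup mem_filter andb_idr //; apply: su.
Qed.

Lemma mult_fact_perm (s t : seq T) : perm_eq s t -> mult_fact s = mult_fact t.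
Proof.
move=> st; rewrite (@mult_factE (undup t)) ?undup_uniq //.
  by apply: eq_bigr => c _; rewrite (permP st).
by move=> c; rewrite mem_undup (perm_mem st).
Qed.

Lemma mult_fact_cons (c : T) (s : seq T) :
  mult_fact (c :: s) = ((count_mem c s).+1 * mult_fact s)%N.
Proof.
set u := undup (c :: s).
have cu : c \in u by rewrite mem_undup mem_head.
rewrite (@mult_factE u) ?undup_uniq => [|//|d]; last by rewrite mem_undup.
rewrite [mult_fact s](@mult_factE u) ?undup_uniq => [|//|d ds]; last first.
  by rewrite mem_undup in_cons ds orbT.
rewrite !(bigD1_seq c) ?undup_uniq //= eqxx add1n factS -mulnA; congr (_ * (_ * _))%N.
by apply: eq_bigr => d /negPf; rewrite eq_sym => ->.
Qed.

End MultiplicityFactorial.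

Section MultiIndexPartitions.
Variable n : nat.
Implicit Types (i c : 'X_{1..n}) (s : seq 'X_{1..n}).

Lemma mnm_lexi_total : total (@mnm_lexi n).
Proof. by move=> a b; apply: le_total. Qed.

Lemma mnm_lexi_trans : transitive (@mnm_lexi n).
Proof. by move=> b a c; apply: le_trans. Qed.

Lemma mnm_lexi_anti : antisymmetric (@mnm_lexi n).
Proof. by move=> a b /le_anti ab; do 2! apply: val_inj. Qed.

(** Partitions become sorted sequences of columns: removing a column from a matrix would change its
    type. *)
Definition is_mpart i s : bool :=
  [&& all (fun c => c != 0%MM) s, sorted (@mnm_lexi n) s
    & (\sum_(c <- s) c)%MM == i].

Lemma part_colsE l (la : 'M[nat]_(n, l)) i :
  is_multipart la i = is_mpart i (part_cols la).
Proof.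
rewrite /is_multipart /is_mpart; congr [&& _, _ & _].
apply/forallP/eqP => [h|<- r].
  apply/mnmP => r; rewrite mnm_sumE big_map big_enum /= -(eqP (h r)).
  by apply: eq_bigr => j _; rewrite mnmE.
apply/eqP; rewrite mnm_sumE big_map big_enum /=.
by apply: eq_bigr => j _; rewrite mnmE.
Qed.

Lemma size_part_cols l (la : 'M[nat]_(n, l)) : size (part_cols la) = l.
Proof. by rewrite size_map size_enum_ord. Qed.

Lemma nth_part_cols l (la : 'M[nat]_(n, l)) (j : 'I_l) r :
  nth 0%MM (part_cols la) j r = la r j.
Proof. by rewrite (nth_map j) ?size_enum_ord // nth_ord_enum mnmE. Qed.

(** A single finite type for the double sum over [l] and [la] in [neg_bell_moment]. *)
Definition mpart_dom (N : nat) := {l : 'I_N & 'M['I_N]_(n, l)}.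

Definition mpart_cols N (p : mpart_dom N) : seq 'X_{1..n} :=
  part_cols (map_mx val (tagged p) : 'M[nat]_(n, tag p)).

Lemma mpart_cols_inj N : injective (@mpart_cols N).
Proof.
move=> [l la] [l' la'] e; have ll' : l = l'.
  by move/(congr1 size): e; rewrite !size_part_cols => /val_inj.
subst l'; congr existT; apply/matrixP => r j; apply: val_inj.
move: e => /(congr1 (fun s => nth 0%MM s j r)); rewrite /mpart_cols /=.
by rewrite !nth_part_cols !mxE.
Qed.

Definition mparts i : seq (seq 'X_{1..n}) :=
  [seq mpart_cols p | p <- enum {: mpart_dom (mdeg i).+1} & is_mpart i (mpart_cols p)].

Lemma mparts_uniq i : uniq (mparts i).
Proof.
rewrite map_inj_uniq; last exact: mpart_cols_inj.
by apply: filter_uniq; apply: enum_uniq.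
Qed.

Lemma mem_mparts i s : (s \in mparts i) = is_mpart i s.
Proof.
apply/mapP/idP => [[p]|hs]; first by rewrite mem_filter => /andP[hp _] ->.
pose la : 'M[nat]_(n, size s) := \matrix_(r, j) (nth 0%MM s j) r.
have la_s : part_cols la = s.
  apply: (@eq_from_nth _ 0%MM) => [|j]; rewrite size_part_cols // => js.
  by apply/mnmP => r; rewrite (nth_part_cols la (Ordinal js)) mxE.
(* These bounds put [s] within the finite type and make [inord] below preserve every entry. *)
have [] : (size s <= mdeg i)%N /\ forall r j, (la r j <= mdeg i)%N.
  by apply: is_multipart_bounded; rewrite part_colsE la_s.
rewrite -ltnS => ls lai.
pose p : mpart_dom (mdeg i).+1 :=
  Tagged (fun l : 'I_(mdeg i).+1 => 'M['I_(mdeg i).+1]_(n, l))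
    ((\matrix_(r, j) inord (la r j)) : 'M['I_(mdeg i).+1]_(n, Ordinal ls)).
have ps : mpart_cols p = s.
  rewrite -[RHS]la_s /mpart_cols; congr part_cols.
  by apply/matrixP => r j; rewrite !mxE /= inordK //; have := lai r j; rewrite mxE.
by exists p; rewrite // mem_filter ps hs mem_enum.
Qed.

Lemma is_mpart_rem i s c : is_mpart i s -> c \in s ->
  [/\ c != 0%MM, (c <= i)%MM & is_mpart (i - c)%MM (rem c s)].
Proof.
move=> /and3P[/allP nz so /eqP si] cs.
have si' : (c + \sum_(d <- rem c s) d)%MM = i.
  by rewrite -si (perm_big _ (perm_to_rem cs)) big_cons.
split; [exact: nz | by rewrite -si' lem_addr | apply/and3P; split].
- by apply/allP => d /mem_rem /nz.
- by apply: subseq_sorted so; [apply: mnm_lexi_trans | apply: rem_subseq].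
by rewrite -si' addmC addmK.
Qed.

(** The inverse of removing c is to insert c and sort again; a sorted sequence is determined by its
    multiset of elements. *)
Lemma rem_mparts i c : c != 0%MM -> (c <= i)%MM ->
  perm_eq [seq rem c s | s <- mparts i & c \in s] (mparts (i - c)%MM).
Proof.
move=> c0 ci; apply: uniq_perm; rewrite ?mparts_uniq //.
  rewrite map_inj_in_uniq ?filter_uniq ?mparts_uniq // => s t.
  rewrite !mem_filter !mem_mparts => /andP[cs /and3P[_ ss _]] /andP[ct /and3P[_ st _]] e.
  apply: (sorted_eq mnm_lexi_trans mnm_lexi_anti) => //.
  by rewrite (perm_trans (perm_to_rem cs)) // e perm_sym perm_to_rem.
move=> t; rewrite mem_mparts; apply/mapP/idP => [[s]|/and3P[nz so /eqP si]].
  by rewrite mem_filter mem_mparts => /andP[cs /is_mpart_rem/(_ cs)[_ _ h]] ->.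
pose s := sort (@mnm_lexi n) (c :: t).
have ss : sorted (@mnm_lexi n) s by apply/sort_sorted/mnm_lexi_total.
have pst : perm_eq s (c :: t) by rewrite perm_sort.
have cs : c \in s by rewrite (perm_mem pst) mem_head.
exists s; last first.
  apply: (sorted_eq mnm_lexi_trans mnm_lexi_anti) => //.
    by apply: subseq_sorted ss; [apply: mnm_lexi_trans | apply: rem_subseq].
  by rewrite -(perm_cons c) -(permPl pst) perm_to_rem.
rewrite mem_filter mem_mparts cs andTb; apply/and3P; split => //.
  by rewrite (perm_all _ pst) /= c0.
by rewrite (perm_big _ pst) big_cons si /= addmC submK.
Qed.

(** * Weighted sums over partitions *)

Section Weights.
Variables (F : fieldType) (hF : [pchar F] =i pred0).
Implicit Types (w : 'X_{1..n} -> F).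

Definition part_weight w s : F := (\prod_(c <- s) w c) / (mult_fact s)%:R.

(** With m the multiplicity of c in [s], the factor m cancels against m! = m (m - 1)!, which takes
    characteristic zero. *)
Lemma part_weight_rem w s c : c \in s ->
  (count_mem c s)%:R * part_weight w s = w c * part_weight w (rem c s).
Proof.
move=> cs; have ps := perm_to_rem cs; rewrite /part_weight.
rewrite (perm_big _ ps) big_cons (mult_fact_perm ps) (permP ps) /= eqxx add1n.
rewrite mult_fact_cons natrM invfM !mulrA; congr (_ / _).
by rewrite mulrC !mulrA mulVf ?mul1r // ((pcharf0P F).1 hF).
Qed.

(** The coefficient of t^i in exp(W), where W has coefficient w_c at each nonzero index c. *)
Definition part_sum w i : F := \sum_(s <- mparts i) part_weight w s.

Lemma part_sum_count w i c : c != 0%MM ->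
  \sum_(s <- mparts i) (count_mem c s)%:R * part_weight w s
    = if (c <= i)%MM then w c * part_sum w (i - c)%MM else 0.
Proof.
move=> c0; rewrite (bigID (fun s : seq _ => c \in s)) /= [X in _ + X]big1 => [|s cs]; last first.
  by rewrite (count_memPn cs) mul0r.
rewrite addr0; case: ifPn => ci; last first.
  rewrite big_seq_cond big1 // => s /andP[]; rewrite mem_mparts => /is_mpart_rem h /h.
  by rewrite (negPf ci) => -[].
rewrite /part_sum -(perm_big _ (rem_mparts c0 ci)) [X in _ * X]big_map big_filter mulr_sumr.
by apply: eq_bigr => s cs; rewrite part_weight_rem.
Qed.

(* The coefficientwise form of d/dt_r exp(W) = (d/dt_r W) exp(W), where W is the
   series with coefficients w. *)
Lemma part_sum_deriv w i r (u : seq 'X_{1..n}) : uniq u -> 0%MM \notin u ->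
    (forall c, c \notin u -> (c r)%:R * w c = 0) ->
  (i r)%:R * part_sum w i
    = \sum_(c <- u | (c <= i)%MM) (c r)%:R * w c * part_sum w (i - c)%MM.
Proof.
move=> uu u0 wu; rewrite [RHS]big_mkcond /=.
(* Double counting over pairs of a partition and a column: [part_sum_count] evaluates the sum for
   fixed c, and exchanging the sums leaves an identity for each partition. *)
transitivity (\sum_(c <- u) (c r)%:R *
    \sum_(s <- mparts i) (count_mem c s)%:R * part_weight w s); last first.
  rewrite [LHS]big_seq [RHS]big_seq; apply: eq_bigr => c cu.
  rewrite part_sum_count; last by apply: contraNneq u0 => <-.
  by case: ifP; rewrite ?mulr0 ?mulrA.
rewrite /part_sum mulr_sumr; under [RHS]eq_bigr => c _ do rewrite mulr_sumr.
rewrite exchange_big /= [LHS]big_seq [RHS]big_seq; apply: eq_bigr => s.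
rewrite mem_mparts => /and3P[_ _ /eqP si].
(* Since [s] sums to i, i_r is the sum of c_r times the multiplicity of c over the distinct columns
   c. *)
transitivity (\sum_(c <- undup s) (c r)%:R * ((count_mem c s)%:R * part_weight w s)).
  under eq_bigr => c _ do rewrite mulrA.
  rewrite -mulr_suml -si mnm_sumE; congr (_ * _).
  rewrite -big_undup_iterop_count natr_sum; apply: eq_bigr => c _.
  by rewrite -natrM Monoid.iteropE iter_addn_0.
(* Both sums reduce to the common elements of [s] and [u]: columns outside [u] vanish by [wu],
   elements of [u] outside [s] have multiplicity zero. *)
rewrite (bigID (mem u)) /= [X in _ + X]big1_seq ?addr0 => [|c /andP[cu]]; last first.
  by rewrite mem_undup => cs; rewrite part_weight_rem // mulrA wu ?mul0r.
rewrite [RHS](bigID (mem s)) /= [X in _ = _ + X]big1 ?addr0 => [|c cs]; last first.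
  by rewrite (count_memPn cs) mul0r mulr0.
rewrite -big_filter -[RHS]big_filter; apply: perm_big; apply: uniq_perm.
- by rewrite filter_uniq ?undup_uniq.
- by rewrite filter_uniq.
by move=> c; rewrite !mem_filter mem_undup andbC.
Qed.

End Weights.
End MultiIndexPartitions.

(** * The moments of the umbra -1.beta.nu *)

Lemma mnm_fact_neq0 (F : fieldType) (hF : [pchar F] =i pred0) n (i : 'X_{1..n}) :
  (mnm_fact i)%:R != 0 :> F.
Proof. by rewrite ((pcharf0P F).1 hF) -lt0n prodn_gt0 // => r; apply: fact_gt0. Qed.

(** The sign (-1)^l and the factorial of the partition are products over the columns, so each column
    absorbs its own share into its weight. *)
Lemma neg_bell_momentE (F : fieldType) n (g : 'X_{1..n} -> F) i :
  neg_bell_moment g i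
    = (mnm_fact i)%:R * part_sum (fun c => - g c / (mnm_fact c)%:R) i.
Proof.
rewrite /neg_bell_moment sig_big_dep /= /part_sum big_map big_filter big_enum_cond mulr_sumr.
apply: eq_big => [p|p _]; first by rewrite part_colsE.
rewrite /mpart_cols; set s := part_cols _; rewrite -!mulrA; congr (_ * _).
have -> : part_moment (map_mx val (tagged p) : 'M[nat]_(n, tag p)) g = \prod_(c <- s) g c.
  exact: big_undup_iterop_count.
have -> : part_fact (map_mx val (tagged p) : 'M[nat]_(n, tag p)) = (\prod_(c <- s) mnm_fact c)%N.
  exact: big_undup_iterop_count.
have prodN : \prod_(c <- s) - g c = (-1) ^+ tag p * \prod_(c <- s) g c.
  under eq_bigr => c _ do rewrite -mulN1r.
  by rewrite big_split /= big_const_seq count_predT size_part_cols -Monoid.iteropE.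
rewrite -/(mult_fact s) /part_weight big_split /= prodfV natr_prod invfM prodN.
by rewrite mulrC -!mulrA; congr (_ * (_ * _)); rewrite mulrC.
Qed.

Lemma mderivXU (F : fieldType) n (r k : 'I_n) :
  ('X_k)^`M(r) = (r == k)%:R :> {mpoly F[n]}.
Proof.
rewrite mderivX mnm1E eq_sym; case: eqVneq => [->|_]; last by rewrite scale0r.
by rewrite -[X in (X - _)%MM]add0m addmK mpolyX0 scale1r.
Qed.

(** The product rule gives a row sum and a column sum of M; symmetry makes them equal, and the
    resulting 2 cancels the factor 1/2. *)
Lemma mderiv_quadratic_gf (F : fieldType) (hF : [pchar F] =i pred0) n (M : 'M[F]_n)
    (symM : M^T = M) (r : 'I_n) :
  (quadratic_gf M)^`M(r) = \sum_s M r s *: 'X_s.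
Proof.
rewrite /quadratic_gf mderivD -[1]mpolyC1 mderivC add0r mderiv_mulC mxE.
under eq_bigr => j _ do rewrite !mxE mulr_suml.
under eq_bigr => j _ do under eq_bigr => k _ do rewrite !mxE mulrAC mulrC.
rewrite linear_sum /=.
under eq_bigr => j _ do rewrite linear_sum /=.
under eq_bigr => j _ do under eq_bigr => k _ do
  rewrite mderiv_mulC mderivM !mderivXU mulrDr.
under eq_bigr => j _ do rewrite big_split /=.
rewrite big_split /= exchange_big /= (bigD1 r) //= eqxx.
rewrite [X in _ + X + _]big1 ?addr0 => [|k rk]; last first.
  by rewrite big1 // => j _; rewrite eq_sym (negPf rk) mul0r mulr0.
rewrite [X in _ + X](bigD1 r) //= eqxx [X in _ + (_ + X)]big1 ?addr0 => [|k rk]; last first.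
  by rewrite big1 // => j _; rewrite eq_sym (negPf rk) !mulr0.
rewrite [X in _ + X](_ : _ = \sum_j (M r j)%:MP * (1 * 'X_j)); last first.
  by apply: eq_bigr => j _; rewrite mulr1 mul1r -{1}symM mxE.
rewrite -mulr2n -[X in _ * X]mulr_natl mulrA -mpolyC_nat -mpolyCM mulVf ?((pcharf0P F).1 hF) //.
by rewrite mul1r; apply: eq_bigr => j _; rewrite mul1r mul_mpolyC.
Qed.

Lemma mnm_factDU n (i : 'X_{1..n}) r :
  mnm_fact (i + U_(r))%MM = ((i r).+1 * mnm_fact i)%N.
Proof.
rewrite /mnm_fact (bigD1 r) //= mnmDE mnm1E eqxx addn1 factS -mulnA.
rewrite [in RHS](bigD1 r) //=; congr (_ * (_ * _))%N.
by apply: eq_bigr => s /negPf sr; rewrite mnmDE mnm1E eq_sym sr addn0.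
Qed.

Section NegBellRecursion.
Variables (F : fieldType) (hF : [pchar F] =i pred0) (n : nat) (M : 'M[F]_n).
Variable g : 'X_{1..n} -> F.
Hypotheses (symM : M^T = M).
Hypothesis gM : forall i, i != 0%MM -> g i = (mnm_fact i)%:R * (quadratic_gf M)@_i.

(** Only the empty sequence partitions 0, since a column c would be nonzero with c <= 0. *)
Lemma neg_bell_moment0 : neg_bell_moment g 0%MM = 1.
Proof.
rewrite neg_bell_momentE /part_sum (_ : mnm_fact _ = 1%N) ?mul1r; last first.
  by apply: big1 => r _; rewrite mnm0E.
rewrite (perm_big [:: [::]]) /=.
  by rewrite big_seq1 /part_weight /mult_fact !big_nil divr1.
apply: uniq_perm; rewrite ?mparts_uniq // => s; rewrite mem_mparts inE.
case: s => [|c s]; first by rewrite /is_mpart /= big_nil eqxx.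
apply/negP => /is_mpart_rem/(_ (mem_head _ _))[/eqP c0 /mnm_lepP c_le _].
by apply: c0; apply/mnmP => r; apply/eqP; have := c_le r; rewrite mnm0E leqn0.
Qed.

(** This is [part_sum_deriv] at i + e_r. The series W is quadratic, so its derivative in t_r is a
    linear form and only the columns e_s + e_r contribute. *)
Lemma neg_bell_momentDU i r : neg_bell_moment g (i + U_(r))%MM
  = - \sum_s M r s * (i s)%:R * neg_bell_moment g (i - U_(s))%MM.
Proof.
set w := fun c => - g c / (mnm_fact c)%:R.
have wE c : c != 0%MM -> w c = - (quadratic_gf M)@_c.
  by move=> c0; rewrite /w gM // mulNr mulrC mulKf // mnm_fact_neq0.
pose u := [seq (U_(s) + U_(r))%MM | s : 'I_n].
have uu : uniq u.
  by rewrite map_inj_uniq ?enum_uniq // => s t /addIm /eqP; rewrite eq_mnm1 => /eqP.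
have u0 : 0%MM \notin u.
  apply/mapP => -[s _ /mnmP/(_ r)]; rewrite mnmDE mnm0E mnm1E mnm1E eqxx.
  by rewrite addn1.
(* For c = d + e_r, c_r w_c is minus the coefficient of t^d in the t_r-derivative of the quadratic
   series; for c_r = 0 both sides vanish. *)
have rw (c : 'X_{1..n}) : (c r)%:R * w c = - \sum_s M r s * (c == (U_(s) + U_(r))%MM)%:R.
  have [c0|c_gt0] := posnP (c r).
    rewrite c0 mul0r big1 ?oppr0 // => t _; case: eqP => [e|_]; last by rewrite mulr0.
    by move: c0; rewrite e mnmDE !mnm1E eqxx addn1.
  have [d ->] : exists d, c = (d + U_(r))%MM.
    by exists (c - U_(r))%MM; rewrite submK // lep1mP -lt0n.
  rewrite wE; last by apply/eqP => /mnmP/(_ r); rewrite mnmDE mnm0E mnm1E eqxx addn1.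
  rewrite mulrN mnmDE mnm1E eqxx addn1 mulr_natl -mcoeff_mderiv mderiv_quadratic_gf //.
  rewrite linear_sum; congr (- _); apply: eq_bigr => t _.
  by rewrite linearZ /= mcoeffX (inj_eq (@addIm _ _)) eq_sym.
have wu c : c \notin u -> (c r)%:R * w c = 0.
  move=> cu; rewrite rw big1 ?oppr0 // => s _; case: eqP => [ce|_]; last by rewrite mulr0.
  by case/mapP: cu; exists s; rewrite ?mem_enum.
have rws s : ((U_(s) + U_(r))%MM r)%:R * w (U_(s) + U_(r))%MM = - M r s.
  rewrite rw (bigD1 s) //= eqxx mulr1 big1 ?addr0 // => t /negPf ts.
  by rewrite (inj_eq (@addIm _ _)) eq_mnm1 eq_sym ts mulr0.
rewrite neg_bell_momentE mnm_factDU natrM [X in X * _]mulrC -mulrA -/w.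
have -> : (i r).+1 = (i + U_(r))%MM r by rewrite mnmDE mnm1E eqxx addn1.
rewrite (part_sum_deriv hF _ uu u0 wu) big_map big_enum_cond /= big_mkcond mulr_sumr -sumrN.
apply: eq_bigr => s _; rewrite rws.
(* For i_s = 0 the terms on both sides vanish, so the truncated difference i - e_s has no effect
   there. *)
have -> : (U_(s) + U_(r) <= i + U_(r))%MM = (i s != 0%N).
  rewrite -lep1mP; apply/mnm_lepP/mnm_lepP => h t; have := h t; rewrite !mnmDE.
    by rewrite leq_add2r.
  by rewrite leq_add2r.
have [-> /=|is0] := eqVneq (i s) 0%N; first by rewrite !mulr0 mul0r oppr0.
have -> : (i + U_(r) - (U_(s) + U_(r)))%MM = (i - U_(s))%MM.
  by rewrite [(U_(s) + _)%MM]addmC -submDA addmK.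
rewrite neg_bell_momentE -/w /=.
(* The factor i_s comes from i! = i_s (i - e_s)!. *)
have {1}-> : i = (i - U_(s) + U_(s))%MM by rewrite submK // lep1mP.
rewrite mnm_factDU mnmBE mnm1E eqxx -{2}[i s]prednK ?lt0n // subn1.
by rewrite natrM; ring.
Qed.

End NegBellRecursion.

Lemma mnm_ind n (P : 'X_{1..n} -> Prop) :
  P 0%MM -> (forall i r, P i -> P (i + U_(r))%MM) -> forall i, P i.
Proof.
move=> P0 PD i; have [d] := ubnP (mdeg i); elim: d => // d IH in i *; rewrite ltnS => id.
have [->//|i0] := eqVneq i 0%MM.
have [r ir] : exists r, i r != 0%N.
  apply/existsP; apply: contraNT i0; rewrite negb_exists => /forallP h.
  by apply/eqP/mnmP => r; rewrite mnm0E; apply/eqP; have := h r; rewrite negbK.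
have ui : (U_(r) <= i)%MM by rewrite lep1mP.
rewrite -(submK ui); apply: PD; apply: IH; apply: leq_trans id.
by rewrite -[in ltnRHS](submK ui) mdegD mdeg1 addn1.
Qed.

(** * Evaluation of shifted powers *)

Section MomentEval.
Variables (F : fieldType) (n : nat).

(** Coefficients outside the support are zero. A common list [u] for several polynomials reduces
    linearity to a termwise check. *)
Lemma moment_evalE (g : 'X_{1..n} -> F) (u : seq 'X_{1..n}) (p : {mpoly F[n]}) :
  uniq u -> {subset msupp p <= u} -> moment_eval g p = \sum_(m <- u) p@_m * g m.
Proof.
move=> uu pu; rewrite [RHS](bigID (mem (msupp p))) /= [X in _ + X]big1 ?addr0 => [|m]; last first.
  by move=> /memN_msupp_eq0 ->; rewrite mul0r.
rewrite -[RHS]big_filter; apply: perm_big; apply: uniq_perm; rewrite ?filter_uniq //.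
by move=> m; rewrite mem_filter andb_idr //; apply: pu.
Qed.

Fact moment_eval_is_scalar (g : 'X_{1..n} -> F) : scalar (moment_eval g).
Proof.
move=> a p q; pose u := undup (msupp (a *: p + q) ++ (msupp p ++ msupp q)).
have uu : uniq u by apply: undup_uniq.
rewrite !(@moment_evalE g u) // => [|m mp|m mp|m mp].
- rewrite mulr_sumr -big_split; apply: eq_bigr => m _.
  by rewrite mcoeffD mcoeffZ mulrDl mulrA.
- by rewrite mem_undup !mem_cat mp !orbT.
- by rewrite mem_undup !mem_cat mp !orbT.
by rewrite mem_undup !mem_cat mp.
Qed.

HB.instance Definition _ (g : 'X_{1..n} -> F) :=
  GRing.isLinear.Build F {mpoly F[n]} F *%R (moment_eval g) (moment_eval_is_scalar g).

Lemma moment_evalX (g : 'X_{1..n} -> F) m : moment_eval g 'X_[m] = g m.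
Proof. by rewrite /moment_eval msuppX big_seq1 mcoeffX eqxx mul1r. Qed.

Implicit Types (c : 'rV[F]_n) (i : 'X_{1..n}).

Lemma shifted_power0 c : shifted_power c 0%MM = 1.
Proof. by apply: big1 => r _; rewrite mnm0E expr0. Qed.

Lemma shifted_powerDU c i r :
  shifted_power c (i + U_(r))%MM = ('X_r + (c 0 r)%:MP) * shifted_power c i.
Proof.
rewrite /shifted_power (bigD1 r) //= mnmDE mnm1E eqxx addn1 exprS -mulrA.
rewrite [in RHS](bigD1 r) //=; congr (_ * (_ * _)).
by apply: eq_bigr => s /negPf sr; rewrite mnmDE mnm1E eq_sym sr addn0.
Qed.

Lemma mderiv_shifted_power c i s :
  (shifted_power c i)^`M(s) = (i s)%:R *: shifted_power c (i - U_(s))%MM.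
Proof.
elim/mnm_ind: i => [|i r IH].
  by rewrite shifted_power0 mnm0E scale0r -mpolyC1 mderivC.
rewrite shifted_powerDU mderivM mderivD mderivC addr0 mderivXU IH mnmDE mnm1E -scalerAr.
rewrite [in RHS]eq_sym; case: eqVneq => [->|sr].
  rewrite mul1r addmK natrD scalerDl /= scale1r addrC; congr (_ + _).
  have [->|ir] := eqVneq (i r) 0%N; first by rewrite !scale0r.
  by rewrite -shifted_powerDU submK // lep1mP.
rewrite mul0r add0r addn0; have [->|is0] := eqVneq (i s) 0%N; first by rewrite !scale0r.
rewrite -shifted_powerDU; congr (_ *: shifted_power c _).
by rewrite addmC addmBA ?lep1mP // [(U_(r) + _)%MM]addmC.
Qed.

End MomentEval.

Section ShiftedRecursion.
Variables (F : fieldType) (n : nat) (M : 'M[F]_n) (a : 'X_{1..n} -> F).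
Hypothesis aDU : forall i r,
  a (i + U_(r))%MM = - \sum_s M r s * (i s)%:R * a (i - U_(s))%MM.

(** An umbral integration by parts: on monomials it is the recursion [aDU], and linearity extends
    it. *)
Lemma moment_eval_mulX r (p : {mpoly F[n]}) :
  moment_eval a ('X_r * p) = - \sum_s M r s * moment_eval a p^`M(s).
Proof.
have pE s : p^`M(s) = \sum_(m <- msupp p) (p@_m * (m s)%:R) *: 'X_[(m - U_(s))%MM].
  rewrite {1}[p]mpolyE (linear_sum (mderiv s)); apply: eq_bigr => m _.
  by rewrite linearZ /= mderivX scalerA.
rewrite {1}[p]mpolyE mulr_sumr linear_sum /=.
under [in RHS]eq_bigr => s _ do rewrite pE linear_sum mulr_sumr /=.
rewrite exchange_big /= -sumrN; apply: eq_bigr => m _.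
rewrite -scalerAr linearZ /= -mpolyXD moment_evalX addmC aDU mulrN mulr_sumr.
congr (- _); apply: eq_bigr => s _.
by rewrite linearZ /= moment_evalX; ring.
Qed.

Lemma moment_eval_shifted_powerDU (c : 'rV[F]_n) i r :
  moment_eval a (shifted_power c (i + U_(r))%MM)
    = c 0 r * moment_eval a (shifted_power c i)
      - \sum_s M r s * (i s)%:R * moment_eval a (shifted_power c (i - U_(s))%MM).
Proof.
rewrite shifted_powerDU mulrDl linearD /= moment_eval_mulX mul_mpolyC linearZ addrC /=.
congr (_ - _); apply: eq_bigr => s _.
by rewrite mderiv_shifted_power linearZ /= mulrA.
Qed.

End ShiftedRecursion.

(** * Hermite polynomials *)

Section HermitePoly.
Variables (F : fieldType) (n : nat) (M : 'M[F]_n).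
Implicit Types (p q : {mpoly F[n]}) (i : 'X_{1..n}).

(** The operator A_r, acting on polynomials in y = x M. *)
Definition hermite_op (r : 'I_n) p : {mpoly F[n]} :=
  'X_r * p - \sum_s M r s *: p^`M(s).

Fact hermite_op_is_linear r : linear (hermite_op r).
Proof.
move=> a p q; rewrite /hermite_op mulrDr -scalerAr scalerBr scaler_sumr [RHS]addrACA.
rewrite -opprD -big_split; congr (_ - _); apply: eq_bigr => s _ /=.
by rewrite linearP scalerDr !scalerA mulrC.
Qed.

HB.instance Definition _ r :=
  GRing.isLinear.Build F {mpoly F[n]} {mpoly F[n]} *:%R (hermite_op r)
    (hermite_op_is_linear r).

(** The fold has the shape of [mpartial], so that the operators appear in the order of the
    differentiations; a general list permits induction. *)
Definition hermite_fold i (rs : seq 'I_n) : {mpoly F[n]} :=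
  foldr (fun r => iter (i r) (hermite_op r)) 1 rs.

Lemma eq_hermite_fold i (j : 'X_{1..n}) (rs : seq 'I_n) :
  {in rs, i =1 j} -> hermite_fold i rs = hermite_fold j rs.
Proof.
elim: rs => //= r rs IH ij; rewrite ij ?mem_head // IH // => s srs.
by rewrite ij // in_cons srs orbT.
Qed.

Lemma mnmBU_neq i (r s : 'I_n) : s != r -> (i - U_(r))%MM s = i s.
Proof. by move=> sr; rewrite mnmBE mnm1E eq_sym (negPf sr) subn0. Qed.

(** The first r in [rs] with nonzero exponent gives the outermost operator, which can be peeled
    off. *)
Lemma hermite_foldB i (rs : seq 'I_n) : uniq rs -> has (fun r => i r != 0%N) rs ->
  exists2 r, i r != 0%N
    & hermite_fold i rs = hermite_op r (hermite_fold (i - U_(r))%MM rs).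
Proof.
elim: rs => //= r rs IH /andP[rrs urs]; have [ir /= irs|ir _] := eqVneq (i r) 0%N.
  have [s is0 e] := IH urs irs; exists s => //.
  have rs0 : r != s by apply: contraNneq is0 => <-; rewrite ir.
  by rewrite mnmBU_neq // ir.
exists r => //; rewrite mnmBE mnm1E eqxx subn1 -iterS prednK ?lt0n //.
congr (iter _ _ _); apply: eq_hermite_fold => s srs; rewrite mnmBU_neq //.
by apply: contraNneq rrs => <-.
Qed.

(** The commutator of d_s and A_r: only the factor X_r fails to commute with d_s. *)
Lemma mderiv_hermite_op r s p :
  (hermite_op r p)^`M(s) = hermite_op r p^`M(s) + (s == r)%:R *: p.
Proof.
rewrite /hermite_op mderivB mderivM mderivXU -mpolyC_nat mul_mpolyC -addrA addrC.
congr (_ - _ + _).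
by rewrite (linear_sum (mderiv s)); apply: eq_bigr => t _ /=; rewrite mderivZ mderiv_comm.
Qed.

(** Each of the k operators contributes one commutator. At k = 0 the coefficient vanishes, so the
    value of [k.-1] there is immaterial. *)
Lemma mderiv_iter_hermite_op r s k p :
  (iter k (hermite_op r) p)^`M(s)
    = iter k (hermite_op r) p^`M(s)
      + ((s == r)%:R * k%:R) *: iter k.-1 (hermite_op r) p.
Proof.
elim: k => [|k IH]; first by rewrite mulr0 scale0r addr0.
rewrite iterS mderiv_hermite_op IH linearD linearZ -addrA iterS; congr (_ + _).
case: k {IH} => [|k] /=; first by rewrite mulr0 scale0r add0r mulr1.
by rewrite -scalerDl -[in RHS]natr1 mulrDr mulr1.
Qed.

(** The derivative d_s commutes with every A_r for r != s, meets the single block of A_s, and kills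
    what lies inside it. *)
Lemma mderiv_hermite_fold i s (rs : seq 'I_n) : uniq rs -> s \in rs ->
  (hermite_fold i rs)^`M(s) = (i s)%:R *: hermite_fold (i - U_(s))%MM rs.
Proof.
have notin rs' : s \notin rs' -> (hermite_fold i rs')^`M(s) = 0.
  elim: rs' => [|r rs' IH] /=; first by rewrite -mpolyC1 mderivC.
  rewrite in_cons negb_or => /andP[/negPf sr srs].
  rewrite mderiv_iter_hermite_op sr mul0r scale0r addr0 IH //.
  by elim: (i r) => //= k ->; rewrite linear0.
have iterZ r k a p : iter k (hermite_op r) (a *: p) = a *: iter k (hermite_op r) p.
  by elim: k => //= k ->; rewrite linearZ.
elim: rs => //= r rs IH /andP[rrs urs]; rewrite in_cons mderiv_iter_hermite_op.
have [/esym er _|sr /= srs] := eqVneq s r; last first.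
  by rewrite mul0r scale0r addr0 (IH urs srs) [in RHS]mnmBU_neq // eq_sym.
subst r; rewrite mul1r mnmBE mnm1E eqxx subn1 notin //.
rewrite -[0](scale0r 0) iterZ scale0r add0r; congr (_ *: iter _ _ _).
by apply: eq_hermite_fold => t trs; rewrite mnmBU_neq //; apply: contraNneq rrs => <-.
Qed.

Definition hermite_poly i := hermite_fold i (enum 'I_n).

Lemma mderiv_hermite_poly i s :
  (hermite_poly i)^`M(s) = (i s)%:R *: hermite_poly (i - U_(s))%MM.
Proof. by apply: mderiv_hermite_fold; rewrite ?enum_uniq ?mem_enum. Qed.

Lemma hermite_poly0 : hermite_poly 0%MM = 1.
Proof. by rewrite /hermite_poly; elim: (enum _) => //= r rs ->; rewrite mnm0E. Qed.

Lemma hermite_polyB i : i != 0%MM -> exists2 r, i r != 0%N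
  & hermite_poly i = hermite_op r (hermite_poly (i - U_(r))%MM).
Proof.
move=> i0; apply: hermite_foldB; rewrite ?enum_uniq //.
apply: contraNT i0 => /hasPn h; apply/eqP/mnmP => r; rewrite mnm0E; apply/eqP.
by have := h r (mem_enum _ r); rewrite negbK.
Qed.

End HermitePoly.

Lemma meval_hermite_op (F : fieldType) n (M : 'M[F]_n) r (p : {mpoly F[n]})
    (v : 'I_n -> F) :
  (hermite_op M r p).@[v] = v r * p.@[v] - \sum_s M r s * (p^`M(s)).@[v].
Proof.
rewrite /hermite_op mevalB mevalM mevalXU (raddf_sum (meval v)); congr (_ - _).
by apply: eq_bigr => s _; rewrite /= mevalZ.
Qed.

(** Both sides start at 1 and obey the same recursion, so strong induction on the degree applies.
    The Hermite side lives over R and the moments over F, whence [iota]. *)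
Lemma rmorph_meval_hermite_poly (R F : fieldType) (iota : {rmorphism R -> F}) n
    (M : 'M[R]_n) (a : 'X_{1..n} -> F) :
  a 0%MM = 1 ->
  (forall i r, a (i + U_(r))%MM
    = - \sum_s map_mx iota M r s * (i s)%:R * a (i - U_(s))%MM) ->
  forall (y : 'rV[R]_n) i,
  iota (hermite_poly M i).@[y 0] = moment_eval a (shifted_power (map_mx iota y) i).
Proof.
move=> a0 aDU y i; have [d] := ubnP (mdeg i); elim: d => // d IH in i *; rewrite ltnS => id.
have [->|i0] := eqVneq i 0%MM.
  by rewrite hermite_poly0 shifted_power0 meval1 rmorph1 -mpolyX0 moment_evalX.
have [r ir ->] := hermite_polyB M i0.
set j := (i - U_(r))%MM; have ij : i = (j + U_(r))%MM by rewrite submK // lep1mP.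
have jd : (mdeg j < d)%N by apply: leq_trans id; rewrite ij mdegD mdeg1 addn1.
rewrite [in RHS]ij (moment_eval_shifted_powerDU aDU) meval_hermite_op rmorphB rmorphM.
rewrite IH // rmorph_sum mxE; congr (_ - _); apply: eq_bigr => s _.
rewrite mderiv_hermite_poly mevalZ !rmorphM rmorph_nat mxE mulrA IH //.
by apply: leq_ltn_trans jd; apply: mdegB.
Qed.

(** * Derivatives of the Gaussian density *)

Section GaussianDerivatives.
Variables (R : realType) (n : nat).
Implicit Types (M : 'M[R]_n) (x v : 'rV[R]_n) (p : {mpoly R[n]}).

(** The difference quotients coincide. Directional derivatives thereby reduce to the one-variable
    chain rule and to univariate polynomials. *)
Lemma is_derive_line (V W : normedModType R) (f : V -> W) (x v : V) (df : W) :
  is_derive x v f df <-> is_derive (0 : R) 1 (fun h => f (h *: v + x)) df.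
Proof.
have e : (fun h : R => h^-1 *: (((fun h => f (h *: v + x)) \o shift 0) (h *: 1)
            - f (0 *: v + x))) = (fun h => h^-1 *: ((f \o shift x) (h *: v) - f x)).
  by apply/funext => h /=; rewrite addr0 scale0r add0r [h *: 1]mulr1.
by split; case=> df_ex df_val; split; move: df_ex df_val; rewrite /derivable /derive e.
Qed.

Lemma is_derive_expR_comp (V : normedModType R) (q : V -> R) (x v : V) (dq : R) :
  is_derive x v q dq -> is_derive x v (expR \o q) (expR (q x) * dq).
Proof.
move/is_derive_line => dq_line; apply/is_derive_line.
rewrite -[in q x](add0r x) -(scale0r v).
exact: (is_derive1_comp (is_derive_expR _) dq_line).
Qed.

Lemma is_derive_mulmx M x v s :
  is_derive x v (fun x => (x *m M) 0 s) ((v *m M) 0 s).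
Proof.
apply/is_derive_line; pose a := (v *m M) 0 s; pose b := (x *m M) 0 s.
have -> : (fun h : R => ((h *: v + x) *m M) 0 s) = horner (a *: 'X + b%:P).
  by apply/funext => h; rewrite !hornerE mulmxDl -scalemxAl mxE [X in X + _]mxE mulrC.
apply: is_derive_eq (is_derive_poly _ _) _.
by rewrite derivD derivZ derivX derivC addr0 !hornerE.
Qed.

(** The chain rule for y = x M, linking analytic and formal derivatives. It is built up from
    constants, variables, products and sums. *)
Lemma is_derive_meval M p x v :
  is_derive x v (fun x => p.@[(x *m M) 0])
    (\sum_s (v *m M) 0 s * (p^`M(s)).@[(x *m M) 0]).
Proof.
have derC (c : R) : is_derive x v (fun x => (c%:MP).@[(x *m M) 0])
    (\sum_s (v *m M) 0 s * ((c%:MP)^`M(s)).@[(x *m M) 0]).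
  rewrite big1 => [|s _]; last by rewrite mderivC meval0 mulr0.
  rewrite (_ : (fun x => _) = cst c); first exact: is_derive_cst.
  by apply/funext => y; rewrite mevalC.
have derM (p1 p2 : {mpoly R[n]}) :
    is_derive x v (fun x => p1.@[(x *m M) 0])
      (\sum_s (v *m M) 0 s * (p1^`M(s)).@[(x *m M) 0]) ->
    is_derive x v (fun x => p2.@[(x *m M) 0])
      (\sum_s (v *m M) 0 s * (p2^`M(s)).@[(x *m M) 0]) ->
    is_derive x v (fun x => (p1 * p2).@[(x *m M) 0])
      (\sum_s (v *m M) 0 s * ((p1 * p2)^`M(s)).@[(x *m M) 0]).
  move=> dp dq; rewrite (_ : (fun x => _)
      = (fun x => p1.@[(x *m M) 0]) * (fun x => p2.@[(x *m M) 0])); last first.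
    by apply/funext => y; rewrite mevalM.
  apply: is_derive_eq (is_deriveM dp dq) _.
  rewrite /GRing.scale /= !mulr_sumr -big_split; apply: eq_bigr => s _ /=.
  by rewrite mderivM mevalD !mevalM; ring.
have derX m : is_derive x v (fun x => 'X_[m].@[(x *m M) 0])
    (\sum_s (v *m M) 0 s * ('X_[m]^`M(s)).@[(x *m M) 0]).
  elim/mnm_ind: m => [|m r IH]; first by rewrite mpolyX0 -mpolyC1; apply: derC.
  rewrite mpolyXD; apply: derM => //.
  rewrite (_ : (fun x => _) = (fun x => (x *m M) 0 r)); last first.
    by apply/funext => y; rewrite mevalXU.
  apply: is_derive_eq (is_derive_mulmx _ _ _ _) _.
  rewrite (bigD1 r) //= mderivXU eqxx meval1 mulr1 big1 ?addr0 // => s /negPf sr.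
  by rewrite mderivXU sr meval0 mulr0.
elim/mpolyind: p => [|c m p _ _ IH]; first by rewrite -mpolyC0; apply: derC.
rewrite (_ : (fun x => _) = (fun x => (c%:MP * 'X_[m]).@[(x *m M) 0])
    + (fun x => p.@[(x *m M) 0])); last first.
  by apply/funext => y; rewrite mevalD mul_mpolyC.
apply: is_derive_eq (is_deriveD (derM _ _ (derC c) (derX m)) IH) _.
by rewrite -big_split; apply: eq_bigr => s _ /=; rewrite mderivD mevalD mulrDr mul_mpolyC.
Qed.

Lemma is_derive_quadratic_form M x v : M^T = M ->
  is_derive x v (fun x => (x *m M *m x^T) 0 0) (2 * (v *m M *m x^T) 0 0).
Proof.
move=> symM; apply/is_derive_line.
pose a := (v *m M *m v^T) 0 0; pose b := (v *m M *m x^T) 0 0; pose c := (x *m M *m x^T) 0 0.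
(* Symmetry of M merges the two cross terms, so the form along the line is a h^2 + 2 b h + c. *)
have bE : (x *m M *m v^T) 0 0 = b.
  by rewrite -[x *m M *m v^T]trmxK mxE !trmx_mul trmxK symM mulmxA.
have -> : (fun h : R => ((h *: v + x) *m M *m (h *: v + x)^T) 0 0)
    = horner (a *: 'X^2 + (2 * b) *: 'X + c%:P).
  apply/funext => h; rewrite !hornerE linearD linearZ /= !mulmxDl !mulmxDr.
  rewrite -!(scalemxAl, scalemxAr).
  have mxD (A B : 'M[R]_1) : (A + B) 0 0 = A 0 0 + B 0 0 by rewrite mxE.
  have mxZ (t : R) (A : 'M[R]_1) : (t *: A) 0 0 = t * A 0 0 by rewrite mxE.
  by rewrite !(mxD, mxZ) bE -/a -/b -/c; ring.
apply: is_derive_eq (is_derive_poly _ _) _.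
by rewrite !derivD !derivZ derivX derivXn derivC addr0 !hornerE.
Qed.

Lemma is_derive_gauss_pdf (S : 'M[R]_n) x v : S^T = S ->
  is_derive x v (gauss_pdf 0 S) (- (v *m (invmx S) *m x^T) 0 0 * gauss_pdf 0 S x).
Proof.
move=> symS; have symM : (invmx S)^T = invmx S by rewrite trmx_inv symS.
pose k := (Num.sqrt ((2 * pi) ^+ n * \det S))^-1.
pose q := (- 2^-1) *: (fun x : 'rV[R]_n => (x *m invmx S *m x^T) 0 0).
have gE : gauss_pdf 0 S = k *: (expR \o q).
  apply/funext => y; rewrite /gauss_pdf subr0 /k; congr (_ * expR _).
  by rewrite /q /= mulrC -mulNr.
rewrite gE; have dq := is_deriveZ (- 2^-1) (is_derive_quadratic_form x v symM).
apply: is_derive_eq (is_deriveZ k (is_derive_expR_comp dq)) _.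
rewrite -[(k *: _) x]/(k * expR (q x)) -[k *: _]/(k * (expR (q x) * (- 2^-1 * (2 * _)))).
by field.
Qed.

(** In the product rule, the polynomial contributes the row r of the inverse of S and the density
    contributes - y_r; together they form - A_r. *)
Lemma partial_meval_gauss_pdf (S : 'M[R]_n) p r : S^T = S ->
  partial r (fun x => p.@[(x *m invmx S) 0] * gauss_pdf 0 S x)
    = (fun x => - (hermite_op (invmx S) r p).@[(x *m invmx S) 0] * gauss_pdf 0 S x).
Proof.
move=> symS; have symM : (invmx S)^T = invmx S by rewrite trmx_inv symS.
apply/funext => x; rewrite /partial.
have d := is_deriveM (is_derive_meval (invmx S) p x (delta_mx 0 r))
  (is_derive_gauss_pdf x (delta_mx 0 r) symS).
rewrite (_ : (fun x => _) = (fun x : 'rV[R]_n => p.@[(x *m invmx S) 0]) * gauss_pdf 0 S) //.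
rewrite (@derive_val _ _ _ _ _ _ _ d) /GRing.scale /= meval_hermite_op.
have -> : ((delta_mx 0 r : 'rV[R]_n) *m invmx S *m x^T) 0 0 = (x *m invmx S) 0 r.
  have trE (A : 'M[R]_1) : A 0 0 = A^T 0 0 by rewrite mxE.
  rewrite trE !trmx_mul trmxK symM trmx_delta mulmxA.
  by rewrite -colE mxE.
under eq_bigr => s _ do rewrite -rowE mxE.
by ring.
Qed.

Lemma mpartial_gauss_pdf (S : 'M[R]_n) i : S^T = S ->
  mpartial i (gauss_pdf 0 S) = (fun x => (-1) ^+ mdeg i
    * (hermite_poly (invmx S) i).@[(x *m invmx S) 0] * gauss_pdf 0 S x).
Proof.
move=> symS; rewrite /mpartial /hermite_poly mdegE -big_enum /=.
(* The scalar k carries the accumulated sign; each differentiation flips it once. *)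
have partialZ k p r : partial r (fun x => k * p.@[(x *m invmx S) 0] * gauss_pdf 0 S x)
    = (fun x => - k * (hermite_op (invmx S) r p).@[(x *m invmx S) 0] * gauss_pdf 0 S x).
  transitivity (partial r (fun x => (k *: p).@[(x *m invmx S) 0] * gauss_pdf 0 S x)).
    by congr partial; apply/funext => x; rewrite mevalZ.
  by rewrite partial_meval_gauss_pdf //; apply/funext => x; rewrite linearZ /= mevalZ !mulNr.
elim: (enum _) => [|r rs IH] /=.
  by apply/funext => x; rewrite big_nil meval1 !mul1r.
rewrite IH big_cons; elim: (i r) => [//|k {}IH].
by rewrite !iterS IH partialZ addSn exprS mulN1r.
Qed.

(** The sign in the definition cancels the one from differentiation, and the positive determinant
    makes the density nonzero. *)
Lemma hermiteE (S : 'M[R]_n) i x : S^T = S -> 0 < \det S ->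
  hermite i x S = (hermite_poly (invmx S) i).@[(x *m invmx S) 0].
Proof.
move=> symS detS; have g0 : gauss_pdf 0 S x != 0.
  rewrite mulf_neq0 ?invr_neq0 ?gt_eqF ?expR_gt0 // sqrtr_gt0 mulr_gt0 ?exprn_gt0 //.
  by rewrite mulr_gt0 ?pi_gt0.
rewrite /hermite mpartial_gauss_pdf // mulrA mulfK // mulrA -exprMn.
by rewrite mulrNN mulr1 expr1n mul1r.
Qed.

End GaussianDerivatives.

(** * Covariance matrices *)

Section CovarianceBilinear.
Local Open Scope ereal_scope.
Context d (T : measurableType d) (R : realType) (P : probability T R).
Implicit Types (I : Type) (Y : T -> R).

Lemma Lfun2_lincomb I (r : seq I) (v : I -> R) (X : I -> T -> R) :
  (forall j, X j \in Lfun P 2%:E) -> (\sum_(j <- r) v j *: X j)%R \in Lfun P 2%:E.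
Proof. by move=> X2; rewrite rpred_sum ?lee1n //= => ? j _; rewrite rpredZ ?lee1n. Qed.

Lemma covariance_lincomb_l I (r : seq I) (v : I -> R) (X : I -> T -> R) Y :
    (forall j, X j \in Lfun P 2%:E) -> Y \in Lfun P 2%:E ->
  covariance P (\sum_(j <- r) v j *: X j)%R Y
    = \sum_(j <- r) (v j)%:E * covariance P (X j) Y.
Proof.
move=> X2 Y2; elim: r => [|j r IH]; first by rewrite !big_nil covariance_cst_l.
rewrite !big_cons covarianceDl ?Lfun2_lincomb ?rpredZ ?lee1n // IH; congr (_ + _).
have -> : (v j *: X j = v j \o* X j)%R by apply/funext => t /=; rewrite mulrC.
by rewrite covarianceZl ?Lfun2_mul_Lfun1 ?Lfun_subset12 ?fin_num_measure.
Qed.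

Lemma covariance_lincomb_r I (r : seq I) (v : I -> R) (X : I -> T -> R) Y :
    (forall j, X j \in Lfun P 2%:E) -> Y \in Lfun P 2%:E ->
  covariance P Y (\sum_(j <- r) v j *: X j)%R
    = \sum_(j <- r) (v j)%:E * covariance P Y (X j).
Proof.
move=> X2 Y2; rewrite covarianceC covariance_lincomb_l //.
by apply: eq_bigr => j _; rewrite covarianceC.
Qed.

End CovarianceBilinear.

Section CovarianceMatrix.
Variables (R : realType) (n : nat) (S : 'M[R]_n).
Hypothesis covS : is_covariance_matrix S.

Lemma covariance_matrix_sym : S^T = S.
Proof.
have [d [T [P [X [_ XS]]]]] := covS; apply/matrixP => j k; rewrite mxE.
by apply: EFin_inj; rewrite -!XS covarianceC.
Qed.

(** The quadratic form is the variance of the linear combination of the X_j with coefficients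
    v_j. *)
Lemma covariance_matrix_psd (v : 'rV[R]_n) : 0 <= (v *m S *m v^T) 0 0.
Proof.
have [d [T [P [X [X2 XS]]]]] := covS; rewrite -lee_fin.
have := variance_ge0 P (\sum_j v 0 j *: (X j : T -> R)).
rewrite /variance covariance_lincomb_l ?Lfun2_lincomb // => /le_trans; apply.
rewrite le_eqVlt; apply/orP; left; apply/eqP.
under eq_bigr => j _.
  rewrite covariance_lincomb_r //.
  under eq_bigr => k _ do rewrite XS -EFinM.
  rewrite sumEFin -EFinM.
  over.
rewrite sumEFin mxE; congr (_%:E).
under [RHS]eq_bigr => k _ do rewrite mxE mulr_suml.
rewrite exchange_big /=; apply: eq_bigr => j _; rewrite mulr_sumr.
by apply: eq_bigr => k _; rewrite mxE; ring.
Qed.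

End CovarianceMatrix.

(** If det S <= 0, the characteristic polynomial of - S is det S <= 0 at 0 and positive far out,
    hence has a root t >= 0. An eigenvector v gives v S v^T = - t v v^T, so t = 0 and v S = 0,
    against invertibility. *)
Lemma psd_det_gt0 (R : rcfType) n (S : 'M[R]_n) : S \in unitmx ->
  (forall v : 'rV[R]_n, 0 <= (v *m S *m v^T) 0 0) -> 0 < \det S.
Proof.
move=> uS psd; rewrite ltNge; apply/negP => detS.
pose p := char_poly (- S).
have p0 : p.[0] <= 0.
  by rewrite horner_coef0 char_poly_det -[- S]scaleN1r detZ mulrA -exprMn mulrNN mulr1 expr1n mul1r.
have lp : lead_coef p = 1 by apply/eqP; apply: char_poly_monic.
have [x0 px0] : exists x0, forall x, x0 <= x -> lead_coef p <= p.[x].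
  by apply: polyrcf.poly_pinfty_gt_lc; rewrite lp.
pose x := Num.max 0 x0.
have [t /andP[t0 _]] : exists2 t, 0 <= t <= x & root p t.
  apply: poly_ivt; first by rewrite le_max lexx.
  by rewrite p0 (le_trans _ (px0 x _)) ?lp ?ler01 // le_max lexx orbT.
rewrite -eigenvalue_root_char => /eigenvalueP[v vS v0].
have vv : 0 < (v *m v^T) 0 0.
  have [r vr] : exists r, v 0 r != 0.
    by apply/rV0Pn.
  rewrite mxE (bigD1 r) //= ltr_wpDr ?sumr_ge0 // => [s _|]; rewrite mxE -expr2 ?sqr_ge0 //.
  by rewrite exprn_even_gt0.
have := psd v; rewrite -[v *m S]opprK -mulmxN vS mulNmx -scalemxAl mxE [X in - X]mxE.
rewrite oppr_ge0 pmulr_lle0 // => t_le0.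
have te : t = 0 by apply: le_anti; rewrite t0 t_le0.
move: vS; rewrite te scale0r mulmxN => /eqP; rewrite oppr_eq0 => /eqP vS.
by case/eqP: v0; rewrite -[v](mulmxK uS) vS mul0mx.
Qed.

Lemma covariance_matrix_det_gt0 (R : realType) n (S : 'M[R]_n) :
  is_covariance_matrix S -> \rank S = n -> 0 < \det S.
Proof.
move=> covS rkS; apply: psd_det_gt0; last exact: covariance_matrix_psd.
by rewrite -row_full_unit /row_full rkS.
Qed.

(** * Both sides compared *)

Lemma umbral_moment_neq0 (K : fieldType) (hK : [pchar K] =i pred0) (A : choiceType)
    (E : malg (cmonom A) K -> K) n (nu : 'I_n -> cmonom A) (p : {mpoly K[n]}) :
  (forall i : 'X_{1..n}, umbral_gf E nu i = p@_i) ->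
  forall i : 'X_{1..n}, i != 0%MM ->
    umbral_moment E nu i = (mnm_fact i)%:R * p@_i.
Proof.
move=> nup i /negPf i0; rewrite -nup /umbral_gf i0 mulrC divfK //.
exact: mnm_fact_neq0.
Qed.

(** Assuming only symmetry and a positive determinant lets this apply to S and to its inverse
    alike. *)
Lemma rmorph_hermite (R : realType) (K : fieldType) (iota : {rmorphism R -> K})
    n (S : 'M[R]_n) (g : 'X_{1..n} -> K) :
  S^T = S -> 0 < \det S ->
  (forall i : 'X_{1..n}, i != 0%MM ->
     g i = (mnm_fact i)%:R * (quadratic_gf (map_mx iota (invmx S)))@_i) ->
  forall (i : 'X_{1..n}) (x : 'rV[R]_n), iota (hermite i x S)
    = moment_eval (neg_bell_moment g) (shifted_power (map_mx iota (x *m invmx S)) i).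
Proof.
move=> symS detS gS i x.
have K0 : [pchar K] =i pred0 by move=> q; rewrite (fmorph_pchar iota) pchar_num.
have symM : (map_mx iota (invmx S))^T = map_mx iota (invmx S).
  by rewrite map_trmx trmx_inv symS.
rewrite hermiteE //; apply: rmorph_meval_hermite_poly.
  exact: neg_bell_moment0.
by move=> j r; apply: neg_bell_momentDU.
Qed.

Unset Implicit Arguments.
Set Strict Implicit.
Set Printing Implicit Defensive.

Theorem proposition4p2 (R : realType) (K : fieldType)
    (iota : {rmorphism R -> K}) (hK : real_or_complex iota)
    (A : choiceType) (E : malg (cmonom A) K -> K)
    (hE : umbral_functional E)
    (n : nat) (S : 'M[R]_n) (hS : is_covariance_matrix S) (rkS : \rank S = n)
    (nu mu : 'I_n -> cmonom A)
    (hnu : forall i : 'X_{1..n},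
       umbral_gf E nu i = (quadratic_gf (map_mx iota (invmx S)))@_i)
    (hmu : forall i : 'X_{1..n},
       umbral_gf E mu i = (quadratic_gf (map_mx iota S))@_i) :
  forall (i : 'X_{1..n}) (x : 'rV[R]_n),
    iota (hermite i x S)
      = moment_eval (neg_bell_moment (umbral_moment E nu))
          (shifted_power (map_mx iota (x *m invmx S)) i)
    /\ iota (hermite_tilde i x S)
      = moment_eval (neg_bell_moment (umbral_moment E mu))
          (shifted_power (map_mx iota x) i).
Proof.
move=> i x; have symS := covariance_matrix_sym hS.
have detS := covariance_matrix_det_gt0 hS rkS.
have uS : S \in unitmx by rewrite unitmxE unitfE gt_eqF.
have K0 : [pchar K] =i pred0 by move=> q; rewrite (fmorph_pchar iota) pchar_num.
split; first exact: rmorph_hermite (umbral_moment_neq0 K0 hnu) _ _.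
(* This exhibits the shift as the one belonging to the inverse of S at the point x S^-1, where
   [hermite_tilde] evaluates [hermite]. *)
have {2}-> : x = x *m invmx S *m invmx (invmx S) by rewrite invmxK mulmxKV.
rewrite /hermite_tilde.
apply: rmorph_hermite => //.
- by rewrite trmx_inv symS.
- by rewrite det_inv invr_gt0.
by rewrite invmxK; apply: umbral_moment_neq0.
Qed.
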